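(* Let $X$ be a homogeneously self-similar graph (not assumed locally finite) with constant inner degree $b$ such that $b>\theta_X-1$, and let $v$ be a vertex in $VX$. Then the following statements are equivalent: (i) The degree of $v$ is infinite. (ii) The vertex $v$ is contained in $F^n$ for any positive integer $n$. (iii) The vertex $v$ is an origin vertex.
   Context: Graph $X$ with vertex set $VX$ and edge set $EX$ is connected, infinite, without loops or multiple edges; vertices may have infinite degree. $d_X$ is the graph distance and $\deg_X x$ the number of neighbours of $x$ in $X$. For $C\subset VX$, the boundary $\theta C$ is the set of vertices in $VX\setminus C$ adjacent to some vertex of $C$; the closure is $\overline{C}=C\cup\theta C$; $\hat C$ is the subgraph of $X$ spanned (induced) by $\overline{C}$. For $F\subset VX$, $\mathcal{C}_XF$ denotes the set of connected components of $VX\setminus F$ (as vertex sets). The reduced graph $X_F$ has vertex set $F$, and two (distinct) vertices $x,y\in F$ are adjacent in $X_F$ iff there is $C\in\mathcal{C}_XF$ with $x,y\in\theta C$. $X$ is self-similar with respect to $F\subset VX$ and $\psi:VX\to F$ if: (F1) no two vertices of $F$ are adjacent in $X$; (F2) the intersection of the closures of two different components in $\mathcal{C}_XF$ contains at most one vertex; (F3) $\psi$ is a graph isomorphism from $X$ to $X_F$. Put $F^0=VX$, $F^n=\psi^n(VX)$ (so $F^1=F$). Elements of $\mathcal{C}_XF$ are called cells. An origin vertex is a fixed point of $\psi$. A self-similar graph $X$ is homogeneously self-similar if: (H1) all cell graphs $\hat C$ ($C\in\mathcal{C}_XF$) are finite and for any cells $C,D$ there is a graph isomorphism $\alpha:\hat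 C\to\hat D$ with $\alpha(\theta C)=\theta D$; (H2) for every cell $C$ and $v_1,v_2,v_3,v_4\in\theta C$ with $v_1\neq v_2$, $v_3\ne v_4$, one has $d_X(v_1,v_2)=d_X(v_3,v_4)$. Put $\theta_X=|\theta C|$ for a cell $C$ (independent of the choice of $C$). A number $b$ is a constant inner degree of $X$ if $b=\deg_{\hat C}v$ for every cell $C$ and every $v\in\theta C$. *)

(* Defs.v *)
From mathcomp Require Import all_boot.
From mathcomp Require Import boolp classical_sets functions cardinality.

Set Implicit Arguments.
Unset Strict Implicit.
Unset Printing Implicit Defensive.

Local Open Scope classical_set_scope.
Local Open Scope card_scope.

(* Vertex sets are possibly infinite, so they
   are arbitrary types rather than finTypes. *)

Record simple_graph := SimpleGraph {
  vertex :> Type;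
  adj : vertex -> vertex -> Prop;
  adj_sym : forall x y, adj x y -> adj y x;
  adj_irrefl : forall x, ~ adj x x }.

Section Graph.
Variable X : simple_graph.
Implicit Types (A C D F : set X) (x y v w : X).

Inductive walk_in A : nat -> X -> X -> Prop :=
| walk_nil x : A x -> walk_in A 0 x x
| walk_cons n x y z :
    A x -> adj x y -> walk_in A n y z -> walk_in A n.+1 x z.

Definition connected_graph := forall x y, exists n, walk_in setT n x y.

(* The default value 0 is only taken when x and y are not joined by a walk. *)
Definition dist x y : nat :=
  xget 0 [set n | walk_in setT n x y
                  /\ forall m, walk_in setT m x y -> n <= m].

Definition neighbours x : set X := [set y | adj x y].

Definition boundary C : set X := [set x | ~ C x /\ exists2 y, C y & adj x y].

Definition gclosure C : set X := C `|` boundary C.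

(* The members of C_X F: connected components of the subgraph induced on the
   complement of F. *)
Definition cell F C : Prop :=
  exists2 x, ~ F x & C = [set y | exists n, walk_in (~` F) n x y].

Definition reduced_adj F x y : Prop :=
  x <> y /\ exists C, [/\ cell F C, boundary C x & boundary C y].

End Graph.

(* f is an isomorphism from the graph with vertex set A and adjacency e onto
   the graph with vertex set B and adjacency e'; the values of f outside A are
   irrelevant.  With e := adj this speaks of induced subgraphs. *)
Definition graph_iso (U V : Type) (A : set U) (e : U -> U -> Prop)
    (B : set V) (e' : V -> V -> Prop) (f : U -> V) : Prop :=
  set_bij A B f /\ forall x y, A x -> A y -> (e x y <-> e' (f x) (f y)).

Section SelfSimilar.
Variables (X : simple_graph) (F : set X) (psi : X -> X).
Implicit Types (C D : set X) (v w : X).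

(* psi : VX -> F is represented by a map X -> X; that its image is (exactly) F
   is part of the last clause. *)
Definition self_similar : Prop :=
  [/\ forall x y, F x -> F y -> ~ adj x y,
      forall C D, cell F C -> cell F D -> C <> D ->
        is_subset1 (gclosure C `&` gclosure D)
    & graph_iso setT (@adj X) F (reduced_adj F) psi].

Definition Fpow (n : nat) : set X := iter n psi @` setT.

Definition origin_vertex v : Prop := psi v = v.

Definition homogeneously_self_similar : Prop :=
  [/\ self_similar,
      forall C, cell F C -> finite_set (gclosure C),
      forall C D, cell F C -> cell F D ->
        exists alpha : X -> X,
          graph_iso (gclosure C) (@adj X) (gclosure D) (@adj X) alpha
          /\ alpha @` boundary C = boundary D
    & forall C, cell F C -> forall v1 v2 v3 v4 : X,
        boundary C v1 -> boundary C v2 -> boundary C v3 -> boundary C v4 ->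
        v1 <> v2 -> v3 <> v4 -> dist v1 v2 = dist v3 v4].

(* The common number of boundary vertices of the cells; well defined when X is
   homogeneously self-similar. *)
Definition theta : nat :=
  xget 0 [set k | exists2 C, cell F C & boundary C #= `I_k].

(* Cell graphs being finite, inner degrees are natural numbers. *)
Definition constant_inner_degree (b : nat) : Prop :=
  forall C v, cell F C -> boundary C v ->
    (neighbours v `&` gclosure C) #= `I_b.

End SelfSimilar.

(* Main.v *)
Require Import Defs.
From mathcomp Require Import all_boot.
From mathcomp Require Import boolp classical_sets functions cardinality.
From mathcomp Require Import zify.

Set Implicit Arguments.
Unset Strict Implicit.
Unset Printing Implicit Defensive.

(** The degrees of [u] and [psi u] are compared by counting over the cells at
    [psi u]: (F2) makes the closures of these cells meet only in [psi u], so if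
    there are [c] of them, [deg (psi u) = b * c] while
    [deg u = (theta - 1) * c].  Hence [psi] preserves infinite degree and
    strictly increases finite degree, which yields (i) <-> (ii).  For
    (ii) -> (iii), two consecutive visits of a walk to [F] are at distance at
    least 2 and lie on the boundary of a common cell, so that [psi] at least
    doubles distances; hence the intersection of all [F^n], which [psi] maps
    into itself, has at most one point. *)

Local Open Scope classical_set_scope.
Local Open Scope card_scope.

(** * Walks, components of the complement of [F], and their boundaries *)

Section Walks.
Variables (X : simple_graph) (F : set X).
Hypothesis Xconn : connected_graph X.

Lemma walk_in_rcons (A : set X) n x y z :
  walk_in A n x y -> adj y z -> A z -> exists m, walk_in A m x z.
Proof.
elim=> [t At tz Az|k s t u As st _ IH uz Az].
  by exists 1%N; apply: walk_cons tz _ => //; apply: walk_nil.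
by have [m tzm] := IH uz Az; exists m.+1; apply: walk_cons st tzm.
Qed.

Lemma neighbour_exists (x : X) : infinite_set [set: X] ->
  exists y, adj x y.
Proof.
move=> Xinf.
have [y /= yx] : exists y, y <> x.
  apply: contrapT => noy; apply: Xinf; apply: (sub_finite_set _ (finite_set1 x)).
  by move=> y _; apply: contrapT => yx; apply: noy; exists y.
have [n xy] := Xconn x y.
case: {n} x y / xy yx => // n x z y _ xz _ _.
by exists z.
Qed.

Definition cell_of (x : X) : set X := [set y | exists n, walk_in (~` F) n x y].

Lemma cell_ofP x : ~ F x -> cell F (cell_of x).
Proof. by exists x. Qed.

Lemma cell_of_id x : ~ F x -> cell_of x x.
Proof. by exists 0%N; apply: walk_nil. Qed.

Lemma boundary_cell_of v x : F v -> ~ F x -> adj v x -> boundary (cell_of x) v.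
Proof.
move=> Fv nFx vx; split; last by exists x => //; apply: cell_of_id.
case=> n xv; suff : ~ F v by [].
by elim: xv => // t.
Qed.

Lemma boundary_cell_sub C : cell F C -> boundary C `<=` F.
Proof.
move=> [x nFx ->] v [nCv [y [n xy] vy]]; apply: contrapT => nFv; apply: nCv.
exact: walk_in_rcons xy (adj_sym vy) nFv.
Qed.

Lemma neighbours_sub_closure x : ~ F x ->
  neighbours x `<=` gclosure (cell_of x).
Proof.
move=> nFx y xy; have [Fy|nFy] := pselect (F y).
  by right; apply: boundary_cell_of => //; apply: adj_sym.
left; exists 1%N; apply: walk_cons xy _ => //; exact: walk_nil.
Qed.

Lemma boundary_cell_of_adj x y : ~ F x -> ~ F y -> adj x y ->
  boundary (cell_of y) `<=` boundary (cell_of x).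
Proof.
move=> nFx nFy xy v bv; have Fv := boundary_cell_sub (cell_ofP nFy) bv.
case: bv => _ [z [n yz] vz]; split.
  by case=> m xv; suff : ~ F v by []; elim: xv.
by exists z => //; exists n.+1; apply: walk_cons yz.
Qed.

End Walks.

(** The element [u] makes [U] inhabited, so that the injection can be total on [T]. *)
Lemma card_le_injection (T U : Type) (u : U) (A : set T) (B : set U) :
  A #<= B -> exists2 f : T -> U, (forall x, A x -> B (f x)) &
    forall x y, A x -> A y -> f x = f y -> x = y.
Proof.
elim/Ppointed: U => U in u B *; first by case: (no u).
move=> /pcard_leP[f]; exists f => [x Ax|x y Ax Ay fxy]; first exact: funS.
by apply: inj fxy; rewrite inE.
Qed.

Lemma injection_card_le (T U : Type) (A : set T) (B : set U) (f : T -> U) :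
  (forall x, A x -> B (f x)) ->
  (forall x y, A x -> A y -> f x = f y -> x = y) -> A #<= B.
Proof.
move=> fAB finj; have fA : f @` A `<=` B by move=> _ [x Ax <-]; apply: fAB.
rewrite -(card_le_eql (@inj_card_eq _ _ A f _)); first exact: subset_card_le.
by move=> x y /set_mem Ax /set_mem Ay; apply: finj.
Qed.

(** * Cells of a homogeneously self-similar graph *)

Section SelfSimilar.
Variables (X : simple_graph) (F : set X) (psi : X -> X).
Hypothesis Xconn : connected_graph X.
Hypothesis Xinf : infinite_set [set: X].
Hypothesis Xhss : homogeneously_self_similar F psi.
Implicit Types (C D : set X) (u v w x y : X).

Let F_notadj x y : F x -> F y -> ~ adj x y.
Proof. by case: Xhss => -[+ _ _] _ _ _; apply. Qed.

Let psiF x : F (psi x).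
Proof. by case: Xhss => -[_ _ [[/(_ x I)]]]. Qed.

Let psi_inj x y : psi x = psi y -> x = y.
Proof.
by case: Xhss => -[_ _ [[_ + _] _]] _ _ _; apply; rewrite inE.
Qed.

Let psi_surj x : F x -> exists u, psi u = x.
Proof.
move=> Fx; have [[_ _ [[_ _ /(_ x Fx)[u _ <-]] _]] _ _ _] := Xhss.
by exists u.
Qed.

Let psi_adj x y : adj x y <-> reduced_adj F (psi x) (psi y).
Proof. by case: Xhss => -[_ _ [_ +]] _ _ _; apply. Qed.

Lemma cell_unique C D x y : cell F C -> cell F D -> x <> y ->
  gclosure C x -> gclosure D x -> gclosure C y -> gclosure D y -> C = D.
Proof.
move=> cC cD xy Cx Dx Cy Dy; apply: contrapT => CD; apply: xy.
by case: Xhss => -[_ + _] _ _ _; apply; [exact: cC|exact: cD|exact: CD|..].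
Qed.

(** An edge of [X] at [v] gives, by (F3), a cell with two boundary vertices. (H1) carries both to
    [C] injectively, so one image differs from [v]. *)
Lemma cell_boundary_other C v : cell F C ->
  exists y, boundary C y /\ v <> y.
Proof.
move=> cC; have [y vy] := neighbour_exists Xconn v Xinf.
have /psi_adj[xy [D [cD Dx Dy]]] := vy.
have [_ _ /(_ _ _ cD cC)[alpha [[[_ ainj _] _] aD]] _] := Xhss.
have [e|ne] := pselect (v = alpha (psi v)); last first.
  by exists (alpha (psi v)); rewrite -aD; split=> //; exists (psi v).
exists (alpha (psi y)); rewrite -aD; split; first by exists (psi y).
by rewrite {1}e => /ainj; rewrite !inE => /(_ (or_intror Dx) (or_intror Dy)).
Qed.

(** * Doubling of distances under [psi] *)

(** Induction on the walk. The second clause treats walks starting inside a cell: [psi u] is the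
    first vertex of [F] reached, and the extra 1 is the step into it. *)
Lemma walk_halving n x w : walk_in setT n x (psi w) ->
  (forall u, x = psi u -> exists2 m, 2 * m <= n & walk_in setT m u w) /\
  (~ F x -> exists u, boundary (cell_of F x) (psi u) /\
     exists2 m, 2 * m + 1 <= n & walk_in setT m u w).
Proof.
move zE: (psi w) => z xz.
elim: xz zE => {n x z} [z _ zE|n x y z _ xy _ /[apply] -[IHF IHnF]].
  split=> [u|]; last by rewrite -zE => /(_ (psiF w)).
  by rewrite -zE => /psi_inj <-; exists 0%N => //; apply: walk_nil.
split=> [u xE|nFx]; last first.
  have [Fy|nFy] := pselect (F y).
    have [u uE] := psi_surj Fy; have [m le_m uw] := IHF _ (esym uE).
    exists u; split; last by exists m => //; lia.
    by rewrite uE; apply: boundary_cell_of => //; apply: adj_sym.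
  have [u [bu [m le_m uw]]] := IHnF nFy; exists u.
  split; last by exists m => //; lia.
  exact: boundary_cell_of_adj bu.
have Fx : F x by rewrite xE.
have nFy : ~ F y by move=> Fy; case: (F_notadj Fx Fy).
have [t [bt [m le_m tw]]] := IHnF nFy.
(* Both [x] and [psi t] bound the cell of [y]: either the walk has returned to [x], or (F3) gives an
   edge from [u] to [t], paid for by leaving and re-entering [F]. *)
have [tx|tx] := pselect (psi t = x).
  by exists m; [lia|rewrite -(psi_inj (x := t) (y := u)) // tx].
exists m.+1; first by lia.
apply: walk_cons tw => //; apply/psi_adj; rewrite -xE; split; first exact/nesym.
exists (cell_of F y); split=> //; first exact: cell_ofP.
exact: boundary_cell_of.
Qed.

Lemma walk_halving_iter k n u w :
  walk_in setT n (iter k psi u) (iter k psi w) ->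
  exists2 m, 2 ^ k * m <= n & walk_in setT m u w.
Proof.
elim: k n => [|k IH] n /= uw; first by exists n => //; rewrite mul1n.
have [/(_ _ erefl)[m le_m /IH[p le_p uw']] _] := walk_halving uw.
by exists p => //; rewrite expnS; lia.
Qed.

Lemma Fpow_iter v : (forall n, 0 < n -> Fpow psi n v) ->
  forall n, exists u, v = iter n psi u.
Proof. by move=> vF [|n]; [exists v|have [//|u _ <-] := vF n.+1; exists u]. Qed.

Lemma Fpow_unique v w :
  (forall n, 0 < n -> Fpow psi n v) -> (forall n, 0 < n -> Fpow psi n w) ->
  v = w.
Proof.
(* The walk length [d] is also the number of preimages taken: [2 ^ d * m <= d] forces [m = 0]. *)
move=> /Fpow_iter vF /Fpow_iter wF; have [d vw] := Xconn v w.
have [[v' vE] [w' wE]] := (vF d, wF d).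
move: vw; rewrite vE wE => /walk_halving_iter[m le_m v'w'].
case: m v'w' le_m => [v'w' _|m _]; last first.
  have := ltn_expl d (isT : 1 < 2); nia.
by inversion v'w'.
Qed.

(** * Infinite degree and preimages under [psi] *)

Lemma finite_neighbours_notin v : ~ F v -> finite_set (neighbours v).
Proof.
move=> nFv; apply: sub_finite_set (neighbours_sub_closure nFv) _.
by have [_ + _ _] := Xhss; apply; apply: cell_ofP.
Qed.

(** If [u] has finite degree, the neighbours of [psi u] are covered by finitely many finite
    closures, one cell [K y] for each neighbour [y] of [u]. *)
Lemma infinite_neighbours_psi u : infinite_set (neighbours (psi u)) ->
  infinite_set (neighbours u).
Proof.
apply: contra_not => fu.
pose K y := xget set0 [set C | [/\ cell F C, boundary C (psi u) &
  boundary C (psi y)]].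
have KP y : neighbours u y -> [/\ cell F (K y), boundary (K y) (psi u) &
    boundary (K y) (psi y)].
  by move=> /psi_adj[_ ?]; apply: (@xgetPex _ _ [set C | [/\ cell F C, _ & _]]).
apply: (@sub_finite_set _ _ (\bigcup_(y in neighbours u) gclosure (K y))).
  move=> x ux; have nFx : ~ F x by move=> Fx; case: (F_notadj (psiF u) Fx).
  have cC := cell_ofP nFx.
  have bC := boundary_cell_of (psiF u) nFx ux.
  (* A second boundary vertex [psi y] identifies the cell of [x] with [K y], by (F2). *)
  have [z [bz uz]] := cell_boundary_other (psi u) cC.
  have [y yE] := psi_surj (boundary_cell_sub cC bz); subst z.
  have uy : neighbours u y by apply/psi_adj; split=> //; exists (cell_of F x).
  exists y => //; have [cK Ku Ky] := KP y uy.
  rewrite -(cell_unique cC cK uz); try by right.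
  by left; apply: cell_of_id.
apply: bigcup_finite => // y /KP[cK _ _].
by have [_ + _ _] := Xhss; apply.
Qed.

(** * Strict growth of degrees under [psi] *)

Variable b : nat.
Hypothesis Xdeg : constant_inner_degree F b.
Hypothesis b_gt : theta F - 1 < b.

Lemma boundary_card_le C v : cell F C -> boundary C v ->
  boundary C #<= neighbours v `&` gclosure C.
Proof.
move=> cC Cv; have [_ Cfin Ciso _] := Xhss.
have [k0 kC] : finite_set (boundary C).
  by apply: sub_finite_set (Cfin _ cC) => x; right.
(* The value [theta F] is realised by some cell [D]; (H1) transports it to [C]. *)
have [D cD Dk] : exists2 D, cell F D & boundary D #= `I_(theta F).
  apply: (@xgetPex _ _ [set k | exists2 C, cell F C & boundary C #= `I_k]).
  by exists k0, C.
have Ck : boundary C #= `I_(theta F).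
  have [alpha [[[_ ainj _] _] <-]] := Ciso _ _ cD cC.
  rewrite (card_eql (inj_card_eq _)) // => x y /set_mem Dx /set_mem Dy.
  by apply: ainj; rewrite inE; right.
rewrite (card_le_eql Ck) (card_le_eqr (Xdeg cC Cv)) card_le_II; lia.
Qed.

(* The cellwise injections of [boundary_card_le] fit together by (F2); the
   value at [v] itself is left over. *)
Lemma reduced_neighbours_injection v : F v ->
  exists f : X -> X, exists p, [/\
    forall y, reduced_adj F v y -> adj v (f y),
    forall y z, reduced_adj F v y -> reduced_adj F v z -> f y = f z -> y = z,
    adj v p & forall y, reduced_adj F v y -> f y <> p].
Proof.
move=> Fv.
pose Q C g := [/\ forall y, boundary C y -> (neighbours v `&` gclosure C) (g y) &
    forall x y, boundary C x -> boundary C y -> g x = g y -> x = y].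
have gex C : exists g, cell F C -> boundary C v -> Q C g.
  have [[cC Cv]|nC] := pselect (cell F C /\ boundary C v); last first.
    by exists id => cC Cv; case: nC.
  have [g g1 g2] := card_le_injection v (boundary_card_le cC Cv).
  by exists g.
have {gex} /choice[g gP] := gex.
have /choice[K KP] : forall y, exists C, reduced_adj F v y ->
    [/\ cell F C, boundary C v & boundary C y].
  move=> y; have [[_ [C CP]]|nvy] := pselect (reduced_adj F v y).
    by exists C.
  by exists set0.
have [x vx] := neighbour_exists Xconn v Xinf.
have nFx : ~ F x by move=> Fx; case: (F_notadj Fv Fx).
have cC := cell_ofP nFx.
have Cv := boundary_cell_of Fv nFx vx.
have adjN w : adj v w -> v <> w by move=> + vw; rewrite -vw; apply: adj_irrefl.
(* The common value is a neighbour of [v], hence a second point besides [v] in both closures, so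
   (F2) applies. *)
have meet C D y z : cell F C -> boundary C v -> boundary C y ->
    cell F D -> boundary D v -> boundary D z -> g C y = g D z -> C = D /\ y = z.
  move=> cC' C'v Cy cD Dv Dz gyz.
  have [C1 C2] := gP _ cC' C'v; have [D1 D2] := gP _ cD Dv.
  have [vg Cg] := C1 _ Cy; have [_ Dg] := D1 _ Dz.
  have CD : C = D.
    apply: (@cell_unique _ _ v (g C y)) => //; [exact: adjN|by right|by right|].
    by rewrite gyz.
  by subst D; split=> //; apply: C2.
(* The spare neighbour is the value at [v] for one cell at [v]; by [meet] only [v] could attain it,
   and [v] is not adjacent to itself in the reduced graph. *)
exists (fun y => g (K y) y), (g (cell_of F x) v); split=> [y vy|y z vy vz||y vy].
- have [cK Kv Ky] := KP _ vy; have [+ _] := gP _ cK Kv.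
  by move=> /(_ _ Ky)[].
- have [cK Kv Ky] := KP _ vy; have [cK' Kv' Kz] := KP _ vz.
  by move=> /(meet _ _ _ _ cK Kv Ky cK' Kv' Kz)[].
- by have [+ _] := gP _ cC Cv; move=> /(_ _ Cv)[].
- have [cK Kv Ky] := KP _ vy.
  by move=> /(meet _ _ _ _ cK Kv Ky cC Cv Cv)[_ yv]; case: vy => /(_ (esym yv)).
Qed.

(** Neighbours of [u] become reduced neighbours of [psi u], which inject into its neighbours; the
    new index [d] goes to the spare one. *)
Lemma card_neighbours_psi d u :
  `I_d #<= neighbours u -> `I_d.+1 #<= neighbours (psi u).
Proof.
move=> /(card_le_injection u)[h hu hinj].
have [f [p [f_adj f_inj p_adj fp]]] := reduced_neighbours_injection (psiF u).
have hr i : i < d -> reduced_adj F (psi u) (psi (h i)).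
  by move=> /hu /psi_adj.
apply: (@injection_card_le _ _ _ _
  (fun i => if i < d then f (psi (h i)) else p)) => [i _|i j /= iS jS].
  by case: ifP => // /hr /f_adj.
case: ifP => [id|/negbT id]; case: ifP => [jd|/negbT jd].
- by move=> /f_inj-/(_ (hr _ id) (hr _ jd))/psi_inj /hinj; apply.
- by move=> /fp; case; apply: hr.
- by move=> /esym /fp; case; apply: hr.
- by move=> _; lia.
Qed.

Lemma card_neighbours_iter d u : `I_d #<= neighbours (iter d psi u).
Proof.
elim: d => [|d IH] /=; first by rewrite II0 card_ge0.
exact: card_neighbours_psi.
Qed.

End SelfSimilar.

Theorem theorem4 (X : simple_graph) (F : set X) (psi : X -> X) (b : nat)
    (Xconn : connected_graph X)
    (Xinf : infinite_set [set: X])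
    (Xhss : homogeneously_self_similar F psi)
    (Xdeg : constant_inner_degree F b)
    (b_gt : theta F - 1 < b)
    (v : X) :
  (infinite_set (neighbours v) <-> (forall n : nat, 0 < n -> Fpow psi n v))
  /\ ((forall n : nat, 0 < n -> Fpow psi n v) <-> origin_vertex psi v).
Proof.
split; split.
(* Infinite degree puts [v] in [F] and passes to its preimage, so the induction descends through
   preimages. *)
- move=> vinf n _; elim: n v vinf => [|n IH] v vinf; first by exists v.
  have Fv : F v by apply: contrapT => /(finite_neighbours_notin Xhss).
  have [[_ _ [[_ _ /(_ v Fv)[u _ uE]] _]] _ _ _] := Xhss; subst v.
  have [|w _ <-] := IH u; last by exists w.
  exact: (infinite_neighbours_psi Xconn Xinf Xhss vinf).
(* A vertex of degree [n] cannot lie in the image of [psi] iterated [n.+1] times, where degrees are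
   at least [n.+1]. *)
- move=> vF [n vn]; have [u uE] := Fpow_iter vF n.+1.
  have := card_neighbours_iter Xconn Xinf Xhss Xdeg b_gt n.+1 u.
  by rewrite -uE (card_le_eqr vn) card_le_II ltnn.
(* The image [psi v] also lies in every [F^n], so uniqueness gives [psi v = v]. *)
- move=> vF; apply: (Fpow_unique Xconn Xhss) => // n n_gt0.
  have [u ->] := Fpow_iter vF n; exists (psi u) => //.
  by rewrite -iterSr.
- by move=> psiv n _; exists v => //; elim: n => //= n ->.
Qed.
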